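(* Let $\mathcal{A}$ be a unital C*-algebra. Then $\mathcal{A}$ has an infinite $C^*_0$-polyhedron.
   Context: Unital C*-algebras are nonzero. Let $\mathcal{A}$ be a unital C*-algebra. A set $\mathcal{X}\subset\mathcal{A}$ is C*-convex if $\sum_{i=1}^n A_i^*x_iA_i\in\mathcal{X}$ whenever $n\ge 1$, $x_1,\dots,x_n\in\mathcal{X}$ and $A_1,\dots,A_n\in\mathcal{A}$ satisfy $\sum_{i=1}^n A_i^*A_i=1$. For $S\subset\mathcal{A}$, $MCL(S)$ denotes the smallest norm-closed C*-convex subset of $\mathcal{A}$ containing $S$. A family $(a_\alpha)_{\alpha<\kappa}$ in $\mathcal{A}$ is a $C^*_0$-polyhedron of size $\kappa$ if for every $\alpha<\kappa$, $a_\alpha\notin MCL(\{a_\beta:\beta<\kappa,\ \beta\neq\alpha\}\cup\{0\})$. It is infinite if $\kappa$ is infinite. *)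

(* Defs.v *)
From HB Require Import structures.
From mathcomp Require Import all_boot all_order all_algebra complex.
From mathcomp Require Import all_classical all_reals all_analysis.
Set Implicit Arguments.
Unset Strict Implicit.
Unset Printing Implicit Defensive.
Import Order.TTheory GRing.Theory Num.Theory.
Import numFieldNormedType.Exports.
Local Open Scope classical_set_scope.
Local Open Scope ring_scope.

Reserved Notation "x ** y" (at level 40, left associativity).
Reserved Notation "x ^†" (at level 2, format "x ^†").

(* Unital C*-algebras over [R[i]], the complex numbers when [R : realType].
   The multiplication is a field of the mixin and not inherited from
   [GRing.Algebra] because Hierarchy-Builder rejects the join of [NormedModule]
   with a ring structure ([Num.NumDomain] already joins the two hierarchies and
   cannot be made to inherit from a new structure).  Norms are elements of
   [R[i]] that are nonnegative, hence real. *)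
HB.mixin Record isCStarAlgebra (R : realType) A
    of CompleteNormedModule R[i] A := {
  cone : A ;
  cmul : A -> A -> A ;
  star : A -> A ;
  cmulA : forall x y z, cmul x (cmul y z) = cmul (cmul x y) z ;
  cmul1l : forall x, cmul cone x = x ;
  cmul1r : forall x, cmul x cone = x ;
  cmulDl : forall x y z, cmul (x + y) z = cmul x z + cmul y z ;
  cmulDr : forall x y z, cmul x (y + z) = cmul x y + cmul x z ;
  cmulZl : forall (c : R[i]) x y, cmul (c *: x) y = c *: cmul x y ;
  cmulZr : forall (c : R[i]) x y, cmul x (c *: y) = c *: cmul x y ;
  cone_neq0 : cone <> 0 ;
  starD : forall x y, star (x + y) = star x + star y ;
  starZ : forall (c : R[i]) x, star (c *: x) = (c^*)%C *: star x ;
  starM : forall x y, star (cmul x y) = cmul (star y) (star x) ;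
  starK : forall x, star (star x) = x ;
  norm_cmul : forall x y : A, `|cmul x y| <= `|x| * `|y| ;
  norm_cstar : forall x : A, `|cmul (star x) x| = `|x| ^+ 2 }.

#[short(type="cstarAlgType")]
HB.structure Definition CStarAlgebra (R : realType) :=
  {A of CompleteNormedModule R[i] A & isCStarAlgebra R A}.

Notation "x ** y" := (cmul x y) : ring_scope.
Notation "x ^†" := (star x) : ring_scope.

Definition cstar_convex (R : realType) (A : cstarAlgType R) (X : set A) :=
  forall (n : nat) (x a : 'I_n -> A), (0 < n)%N -> (forall i, X (x i)) ->
    \sum_(i < n) (a i)^† ** a i = cone ->
    X (\sum_(i < n) (a i)^† ** x i ** a i).

Definition MCL (R : realType) (A : cstarAlgType R) (S : set A) : set A :=
  smallest [set X | closed X /\ cstar_convex X] S.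

(* The condition depends on the index set of the family only up to bijection,
   so an arbitrary type [I] stands for the set of ordinals below [kappa]. *)
Definition cstar0_polyhedron (R : realType) (A : cstarAlgType R) (I : Type)
    (a : I -> A) :=
  forall i : I, ~ MCL ([set a j | j in [set j | j <> i]] `|` [set 0]) (a i).

(* Main.v *)
(* The scalar points n + n^2 i, n >= 1, lie on a parabola, so each of them is
   strictly separated from the others and from 0 by a real affine function
   f(z) = 2 Re (w z) + r.  The set of the x with w x + (w x)^* + r positive is
   closed and C*-convex and contains exactly the points with f >= 0; it
   separates one point of the family from the rest.

   Positivity is handled without spectra: x is positive when it is self-adjoint
   and |T - x| <= T for some real T.  Two facts replace the functional calculus:
   |a^2| <= |a^2 + b^2| for commuting self-adjoint a and b, and approximate
   square roots by polynomials in x.  For the positivity of c^* c when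
   |c| <= 1, put G = 1 - c^* c, L = 1 - c c^* and d = c G^n.  Then d^* d + d d^*
   is a sum of two self-adjoint squares and equals
   G^2n (1 - G) + L^2n (1 - L), while 1 - L^2n (1 - L) is positive as
   L >= 0.  Hence 0 <= G^(2n+1) <= 1 + G^2n for all n, which forces |G| <= 1. *)
Require Import Defs.
From HB Require Import structures.
From mathcomp Require Import all_boot all_order all_algebra complex.
From mathcomp Require Import all_classical all_reals all_analysis.
From mathcomp Require Import ring lra zify.
Import numFieldNormedType.Exports.
Local Open Scope classical_set_scope.

Set Implicit Arguments.
Unset Strict Implicit.
Unset Printing Implicit Defensive.
Import Order.TTheory GRing.Theory Num.Theory.
Local Open Scope ring_scope.

(* An alias carrying only the algebra structure, because the normed module
   structure of [A] cannot be joined with a ring structure. *)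
Definition calg (R : realType) (A : cstarAlgType R) : Type := A.

HB.instance Definition _ (R : realType) (A : cstarAlgType R) :=
  GRing.Zmodule.copy (calg A) A.

Fact cone_neq0b (R : realType) (A : cstarAlgType R) :
  (cone : calg A) != 0.
Proof. by apply/eqP; exact: cone_neq0. Qed.

HB.instance Definition _ (R : realType) (A : cstarAlgType R) :=
  GRing.Zmodule_isNzRing.Build (calg A) (@cmulA R A) (@cmul1l R A)
    (@cmul1r R A) (@cmulDl R A) (@cmulDr R A) (cone_neq0b A).

(** * Structure of a real algebra, through which [horner_alg] evaluates real polynomials at an
    element *)

Section RealAlgebra.
Variables (R : realType) (A : cstarAlgType R).

Definition rscale (r : R) (x : calg A) : calg A := r%:C%C *: (x : A).

Fact rscaleA a b v : rscale a (rscale b v) = rscale (a * b) v.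
Proof. by rewrite /rscale scalerA rmorphM. Qed.

Fact rscale1 : left_id 1 rscale.
Proof. by move=> v; rewrite /rscale rmorph1 scale1r. Qed.

Fact rscaleDr : right_distributive rscale +%R.
Proof. by move=> a u v; exact: scalerDr. Qed.

Fact rscaleDl v : {morph rscale^~ v : a b / a + b}.
Proof. by move=> a b; rewrite /rscale rmorphD; exact: scalerDl. Qed.

HB.instance Definition _ := GRing.Zmodule_isLmodule.Build R (calg A)
  rscaleA rscale1 rscaleDr rscaleDl.

Fact rscaleAl (a : R) (u v : calg A) : a *: (u * v) = a *: u * v.
Proof. by apply/esym; exact: (@cmulZl R A). Qed.

HB.instance Definition _ := GRing.Lmodule_isLalgebra.Build R (calg A) rscaleAl.

Fact rscaleAr (a : R) (u v : calg A) : a *: (u * v) = u * (a *: v).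
Proof. by apply/esym; exact: (@cmulZr R A). Qed.

HB.instance Definition _ := GRing.Lalgebra_isAlgebra.Build R (calg A) rscaleAr.

End RealAlgebra.

(** * Norm, adjoint and self-adjoint elements *)

Section CStarTheory.
Variables (R : realType) (A : cstarAlgType R).
Local Notation B := (calg A).
Implicit Types x y z a b c d s t u : B.

(** The norm takes values in [R[i]], where the order is only partial; its real part loses nothing
    and allows real arithmetic. *)
Definition nrm x : R := complex.Re `|x : A|.
Definition adj x : B := star (x : A).
Definition imu : B := 'i%C *: (cone : A).

Lemma nrmE x : `|x : A| = (nrm x)%:C%C.
Proof.
have := normr_ge0 (x : A); rewrite /nrm; case: (`|x : A|) => a b.
by rewrite lecE /= => /andP[/eqP -> _].
Qed.

Lemma nrm_ge0 x : 0 <= nrm x.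
Proof. by have := normr_ge0 (x : A); rewrite nrmE ler0c. Qed.

Lemma nrmD x y : nrm (x + y) <= nrm x + nrm y.
Proof. by have := ler_normD (x : A) (y : A); rewrite !nrmE -rmorphD lecR. Qed.

Lemma nrmN x : nrm (- x) = nrm x.
Proof. by rewrite /nrm normrN. Qed.

Lemma nrmBC x y : nrm (x - y) = nrm (y - x).
Proof. by rewrite -nrmN opprB. Qed.

Lemma nrmZ (r : R) x : nrm (r *: x) = `|r| * nrm x.
Proof.
have := normrZ r%:C%C (x : A).
rewrite normc_def /= expr0n /= addr0 sqrtr_sqr (nrmE x) -rmorphM.
by rewrite -[_ *: _]/(r *: x : B) nrmE => /complexI.
Qed.

Lemma nrmM x y : nrm (x * y) <= nrm x * nrm y.
Proof. by have := norm_cmul (x : A) (y : A); rewrite !nrmE -rmorphM lecR. Qed.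

Lemma nrm_adjM x : nrm (adj x * x) = nrm x ^+ 2.
Proof.
by have := norm_cstar (x : A); rewrite !nrmE -rmorphXn => /complexI.
Qed.

Lemma adjD x y : adj (x + y) = adj x + adj y. Proof. exact: starD. Qed.
Lemma adjM x y : adj (x * y) = adj y * adj x. Proof. exact: starM. Qed.
Lemma adjK x : adj (adj x) = x. Proof. exact: starK. Qed.
Lemma adjZ (r : R) x : adj (r *: x) = r *: adj x.
Proof. by rewrite /adj starZ conjc_real. Qed.
Lemma adj1 : adj 1 = 1.
Proof. by have := adjM (adj 1) 1; rewrite mulr1 adjK mulr1. Qed.
Lemma adjN x : adj (- x) = - adj x.
Proof. by rewrite -scaleN1r adjZ scaleN1r. Qed.
Lemma adjB x y : adj (x - y) = adj x - adj y.
Proof. by rewrite adjD adjN. Qed.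
Lemma adj0 : adj 0 = 0. Proof. by rewrite -(scale0r 0) adjZ !scale0r. Qed.
Lemma adj_alg (r : R) : adj r%:A = r%:A. Proof. by rewrite adjZ adj1. Qed.
Lemma adjXn x n : adj (x ^+ n) = adj x ^+ n.
Proof. by elim: n => [|n IH]; rewrite ?expr0 ?adj1 // exprS adjM IH exprSr. Qed.

Lemma imu_comm x : imu * x = x * imu.
Proof. by rewrite /imu [LHS]cmulZl [RHS]cmulZr cmul1l cmul1r. Qed.
Lemma imuM : imu * imu = -1.
Proof.
rewrite /imu [LHS]cmulZl cmul1l scalerA -expr2 sqr_i scaleN1r //.
Qed.
Lemma adj_imu : adj imu = - imu.
Proof.
have c1 : star (cone : A) = cone := adj1.
have ci : ('i^*)%C = - 'i%C :> R[i].
  by apply/eqP; rewrite eq_complex /= oppr0 !eqxx.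
by rewrite /adj /imu starZ c1 ci [LHS]scaleNr.
Qed.

Lemma nrm1 : nrm 1 = 1.
Proof.
have n0 : nrm 1 != 0.
  apply/eqP => n0; apply: (@cone_neq0 R A); apply/normr0_eq0.
  by rewrite (nrmE cone) [nrm _]n0.
by apply: (mulfI n0); rewrite -expr2 -nrm_adjM adj1 !mulr1.
Qed.

Lemma nrm_alg (r : R) : nrm r%:A = `|r|.
Proof. by rewrite nrmZ nrm1 mulr1. Qed.

Lemma nrm_adj x : nrm (adj x) = nrm x.
Proof.
suff le y : nrm y <= nrm (adj y) by apply/le_anti; rewrite le -{2}(adjK x) le.
have := nrmM (adj y) y; rewrite nrm_adjM expr2.
have := nrm_ge0 y; rewrite le_eqVlt => /orP[/eqP <- _|y0]; first exact: nrm_ge0.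
by rewrite ler_pM2r.
Qed.

Definition sa x := adj x = x.

Lemma sa_alg (r : R) : sa r%:A. Proof. exact: adj_alg. Qed.
Lemma sa1 : sa 1. Proof. exact: adj1. Qed.
Lemma saD x y : sa x -> sa y -> sa (x + y).
Proof. by rewrite /sa adjD => -> ->. Qed.
Lemma saB x y : sa x -> sa y -> sa (x - y).
Proof. by rewrite /sa adjB => -> ->. Qed.
Lemma saZ (r : R) x : sa x -> sa (r *: x).
Proof. by rewrite /sa adjZ => ->. Qed.
Lemma saX x n : sa x -> sa (x ^+ n). Proof. by rewrite /sa adjXn => ->. Qed.
Lemma saM x y : sa x -> sa y -> x * y = y * x -> sa (x * y).
Proof. by rewrite /sa adjM => -> -> ->. Qed.

Lemma nrm_sa2 x : sa x -> nrm (x ^+ 2) = nrm x ^+ 2.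
Proof. by move=> xs; rewrite -nrm_adjM xs expr2. Qed.

(** Repeated squaring with the C*-identity. It replaces the spectral radius formula when powers of a
    self-adjoint element must be bounded from below. *)
Lemma nrm_saX2n x k : sa x -> nrm (x ^+ (2 ^ k)) = nrm x ^+ (2 ^ k).
Proof.
move=> xs; elim: k => [|k IH]; first by rewrite expn0 !expr1.
by rewrite expnSr !exprM nrm_sa2 ?IH //; exact: saX.
Qed.

Lemma nrmX x n : nrm (x ^+ n) <= nrm x ^+ n.
Proof.
elim: n => [|n IH]; first by rewrite !expr0 nrm1.
rewrite !exprS (le_trans (nrmM _ _)) // ler_wpM2l ?nrm_ge0 //.
Qed.

Local Notation "p \[ x ]" := (horner_alg x p) (at level 2, format "p \[ x ]").

Lemma sa_horner x p : sa x -> sa (p\[x]).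
Proof.
move=> xs; elim/poly_ind: p => [|p c IH]; first by rewrite /sa rmorph0 adj0.
rewrite rmorphD rmorphM /= horner_algX horner_algC.
apply: saD; last exact: sa_alg.
apply: saM => //.
by rewrite -[X in _ * X = X * _](horner_algX x) -!rmorphM mulrC.
Qed.

Lemma comm_horner x y p : GRing.comm y x -> GRing.comm y p\[x].
Proof.
move=> xy; elim/poly_ind: p => [|p c IH].
  by rewrite rmorph0; exact: commr0.
rewrite rmorphD rmorphM /= horner_algX horner_algC.
apply: commrD; first exact: commrM.
by rewrite /GRing.comm mulr_algl mulr_algr.
Qed.

(* [a + i b] is normal with square modulus [a^2 + b^2] and real part [a]. *)
Lemma nrm_sum_sq a b : sa a -> sa b -> a * b = b * a ->
  nrm (a ^+ 2) <= nrm (a ^+ 2 + b ^+ 2).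
Proof.
move=> sa_a sa_b ab; rewrite nrm_sa2 //.
pose z := a + imu * b.
have zs : adj z = a - imu * b.
  by rewrite adjD adjM sa_a sa_b adj_imu mulrN imu_comm.
have -> : a ^+ 2 + b ^+ 2 = adj z * z.
  have ab' : a * (imu * b) = imu * b * a.
    by rewrite mulrA -imu_comm -!mulrA ab.
  have bb : imu * b * (imu * b) = - b ^+ 2.
    by rewrite -mulrA (mulrA b) -(imu_comm b) !mulrA imuM mulN1r mulNr.
  rewrite zs mulrDr !mulrBl ab' bb opprK expr2.
  by rewrite [RHS]addrA subrK.
rewrite nrm_adjM lerXn2r ?nnegrE ?nrm_ge0 //.
have : 2 * nrm a <= 2 * nrm z.
  rewrite -[2 in X in X <= _]ger0_norm // -nrmZ.
  have -> : 2 *: a = adj z + z by rewrite zs /z addrACA addNr addr0 scaler_nat.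
  by rewrite (le_trans (nrmD _ _)) // nrm_adj; lra.
by rewrite ler_pM2l.
Qed.

End CStarTheory.

Lemma expr_lt (R : realType) (z e : R) : 0 <= z < 1 -> 0 < e ->
  exists k, z ^+ k < e.
Proof.
move=> /andP[z0 z1] e0; have z1' : `|z| < 1 by rewrite ger0_norm.
have /cvgr0Pnorm_lt/(_ e e0) [k _ /(_ k (leqnn k)) /=] := cvg_expr z1'.
by rewrite ger0_norm ?exprn_ge0 // => ?; exists k.
Qed.

(** * Positive elements, approximate square roots and commuting products *)

Section Positivity.
Variables (R : realType) (A : cstarAlgType R).
Local Notation B := (calg A).
Implicit Types (x y z a b c d s t u : B) (p q : {poly R}).
Local Notation "p \[ x ]" := (horner_alg x p) (at level 2, format "p \[ x ]").

Lemma nrm_dist x y z : nrm (x - z) <= nrm (x - y) + nrm (y - z).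
Proof. by apply: le_trans (nrmD _ _); rewrite addrA subrK. Qed.

Lemma nrm_le_dist x y : nrm x <= nrm y + nrm (x - y).
Proof. by apply: le_trans (nrmD _ _); rewrite [y + _]addrC subrK. Qed.

Lemma nrm_algB (S T : R) x y :
  nrm (S%:A - y) <= nrm (T%:A - x) + `|S - T| + nrm (x - y).
Proof.
rewrite -(nrm_alg A) scalerBl.
apply: le_trans (lerD (nrmD _ _) (lexx _)); apply: le_trans (nrmD _ _).
by rewrite [_ - x + _]addrC !addrA !subrK.
Qed.

Lemma nrm_hornerC x (r : R) p : nrm (r%:P * p)\[x] = `|r| * nrm p\[x].
Proof. by rewrite rmorphM /= horner_algC mulr_algl nrmZ. Qed.

(* The iteration [v <- (q + v^2) / 2] converges to [1 - sqrt (1 - q)]. *)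
Lemma sqrt_1B_approx x q (r e : R) : nrm q\[x] <= r -> r < 1 -> 0 < e ->
  exists p, nrm (1 - q - p ^+ 2)\[x] <= e.
Proof.
move=> qr r1 e0; have r0 : 0 <= r := le_trans (nrm_ge0 _) qr.
pose h : {poly R} := (2^-1)%:P.
have h2 : 2 * h = 1 by rewrite /h -[2]polyC_natr -rmorphM mulfV.
pose v := fix v k := if k is k'.+1 then h * (q + v k' ^+ 2) else 0.
have v0 : v 0%N = 0 by [].
have vS k : v k.+1 = h * (q + v k ^+ 2) by [].
clearbody v.
have vr k : nrm (v k)\[x] <= r.
  elim: k => [|k IH].
    by rewrite v0 rmorph0 -(scale0r 0) nrmZ normr0 mul0r.
  rewrite vS nrm_hornerC ger0_norm ?invr_ge0 // rmorphD rmorphXn /=.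
  have n2 := le_trans (nrmX (v k)\[x] 2) (lerXn2r 2 (nrm_ge0 _) r0 IH).
  have := nrmD q\[x] ((v k)\[x] ^+ 2).
  have : r ^+ 2 <= r by rewrite expr2 ler_piMl // ltW.
  lra.
have dv k : nrm (v k.+1 - v k)\[x] <= r ^+ k.
  elim: k => [|k IH].
    by rewrite v0 subr0 expr0 (le_trans (vr 1%N)) // ltW.
  (* The constant term [q] cancels and a difference of squares remains; both iterates have norm at
     most [r], so each step contracts by the factor [r]. *)
  have -> : v k.+2 - v k.+1 = (2^-1)%:P * ((v k.+1 - v k) * (v k.+1 + v k)).
    transitivity (h * (q + v k.+1 ^+ 2) - h * (q + v k ^+ 2)).
      by rewrite -!vS.
    by rewrite -mulrBr -/h; congr (h * _); ring.
  rewrite nrm_hornerC ger0_norm ?invr_ge0 // rmorphM /=.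
  have s2 : nrm (v k.+1 + v k)\[x] <= 2 * r.
    by rewrite rmorphD (le_trans (nrmD _ _)) //= mulr_natl mulr2n lerD.
  rewrite ler_pdivrMl // (le_trans (nrmM _ _)) //.
  by rewrite exprS mulrA mulrC ler_pM ?nrm_ge0.
have [k rk] := expr_lt (introT andP (conj r0 r1)) (divr_gt0 e0 (ltr0n R 2)).
(* The defect [1 - q - (1 - v k)^2] equals [2 (v k - v k.+1)], whence the choice of [k] with
   [r ^+ k < e / 2]. *)
exists (1 - v k).
have -> : 1 - q - (1 - v k) ^+ 2 = (-2)%:P * (v k.+1 - v k).
  rewrite rmorphN /= polyC_natr vS mulNr mulrBr mulrA h2; ring.
rewrite nrm_hornerC normrN ger0_norm //.
have := dv k; lra.
Qed.

Definition pos x := sa x /\ exists T : R, nrm (T%:A - x) <= T.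

(** With [M = T + e / 2] and [q = (T - x) / M], the norm of [q] is at most [T / M < 1] and
    [M (1 - q) = x + e / 2]. The shift by [e / 2] makes the bound strict and costs half of the
    error. The root is a polynomial in [x], so it commutes with whatever commutes with [x]. *)
Lemma approx_sqrt x (e : R) : pos x -> 0 < e ->
  exists s, [/\ sa s, nrm (x - s ^+ 2) <= e &
    forall y, GRing.comm y x -> GRing.comm y s].
Proof.
move=> [xs [T xT]] e0; have T0 : 0 <= T := le_trans (nrm_ge0 _) xT.
pose M := T + e / 2; have M0 : 0 < M by rewrite /M; lra.
pose q : {poly R} := (M^-1)%:P * (T%:P - 'X).
have Mq : M%:P * q = T%:P - 'X.
  by rewrite mulrA -rmorphM /= mulfV ?mul1r // gt_eqF.
have qr : nrm q\[x] <= T / M.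
  rewrite nrm_hornerC rmorphB /= horner_algC horner_algX.
  by rewrite gtr0_norm ?invr_gt0 // mulrC ler_pM2r ?invr_gt0.
have r1 : T / M < 1 by rewrite ltr_pdivrMr // mul1r /M; lra.
have [|p hp] := sqrt_1B_approx (e := e / 2 / M) qr r1.
  by rewrite !divr_gt0.
exists ((Num.sqrt M)%:P * p)\[x]; split.
- exact: sa_horner.
- rewrite -rmorphXn /= exprMn -rmorphXn /= sqr_sqrtr ?(ltW M0) //.
  rewrite -[X in X - _]horner_algX -rmorphB /=.
  have -> : 'X - M%:P * p ^+ 2 = M%:P * (1 - q - p ^+ 2) - (e / 2)%:P.
    by rewrite !mulrBr Mq /M rmorphD /=; ring.
  rewrite rmorphB /= (le_trans (nrmD _ _)) // nrmN horner_algC nrm_alg.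
  rewrite nrm_hornerC gtr0_norm // (gtr0_norm (divr_gt0 e0 _)) //.
  by move: hp; rewrite ler_pdivlMr // mulrC; lra.
- by move=> y; exact: comm_horner.
Qed.

(** For [w = T - a^2], [w^2 = T^2 - a^2 (2T - a^2)]. The subtracted term is nearly the square of
    [s = sqrt (2T) a p], where [p^2] approximates [1 - a^2 / (2T)]. Hence [nrm_sum_sq] bounds [w^2]
    by [w^2 + s^2], which is close to [T^2]. *)
Lemma nrm_algB_sq a (T : R) : sa a -> 0 < T -> nrm a ^+ 2 <= T ->
  nrm (T%:A - a ^+ 2) <= T.
Proof.
move=> sa_a T0 aT.
pose q : {poly R} := ((2 * T)^-1)%:P * 'X^2.
have T2 : 0 < 2 * T by rewrite mulr_gt0.
have Tq : (2 * T)%:P * q = 'X^2.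
  by rewrite mulrA -rmorphM /= mulfV ?mul1r // gt_eqF.
have qr : nrm q\[a] <= 2^-1.
  rewrite nrm_hornerC rmorphXn /= horner_algX nrm_sa2 //.
  rewrite gtr0_norm ?invr_gt0 // ler_pdivrMl //.
  by rewrite mulrAC mulfV // mul1r.
suff : nrm (T%:A - a ^+ 2) ^+ 2 <= T ^+ 2.
  by rewrite ler_pXn2r // nnegrE ?nrm_ge0 // ltW.
apply/ler_addgt0Pr => e e0.
(* The error of [p^2] gets multiplied by [2T] and by [a^2], of norm at most [T]. *)
have [||p hp] := sqrt_1B_approx (e := e / (2 * T ^+ 2)) qr.
- lra.
- by rewrite divr_gt0 // mulr_gt0 // exprn_gt0.
pose w : {poly R} := T%:P - 'X^2.
pose s : {poly R} := (Num.sqrt (2 * T))%:P * 'X * p.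
have -> : T%:A - a ^+ 2 = w\[a].
  by rewrite rmorphB rmorphXn /= horner_algC horner_algX.
have sa_w : sa w\[a] by exact: sa_horner.
have sa_s : sa s\[a] by exact: sa_horner.
have cws : w\[a] * s\[a] = s\[a] * w\[a] by rewrite -!rmorphM mulrC.
rewrite -nrm_sa2 // (le_trans (nrm_sum_sq sa_w sa_s cws)) //.
have ws : w ^+ 2 + s ^+ 2 =
    (T ^+ 2)%:P - (2 * T)%:P * ((1 - q - p ^+ 2) * 'X^2).
  transitivity (w ^+ 2 + (2 * T)%:P * 'X^2 * p ^+ 2).
    by rewrite /s !exprMn -rmorphXn /= sqr_sqrtr // ltW.
  rewrite !(mulrBl, mulrBr) [_ * (q * _)]mulrA Tq /w; ring.
rewrite -!rmorphXn -rmorphD /= ws rmorphB /=.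
rewrite (le_trans (nrmD _ _)) // nrmN nrm_hornerC horner_algC nrm_alg.
rewrite (gtr0_norm T2) ger0_norm ?sqr_ge0 // lerD2l rmorphM rmorphXn /=.
rewrite horner_algX -ler_pdivlMl // (le_trans (nrmM _ _)) //.
have -> : (2 * T)^-1 * e = e / (2 * T ^+ 2) * T.
  by field; rewrite gt_eqF.
by rewrite ler_pM ?nrm_ge0 // nrm_sa2.
Qed.

Lemma pos_sq a : sa a -> pos (a ^+ 2).
Proof.
move=> sa_a; split; first exact: saX.
exists (nrm a ^+ 2 + 1); apply: nrm_algB_sq => //; last by rewrite lerDl.
by rewrite ltr_wpDl ?sqr_ge0.
Qed.

Lemma posD x y : pos x -> pos y -> pos (x + y).
Proof.
move=> [xs [T xT]] [ys [S yS]]; split; first exact: saD.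
exists (T + S); rewrite scalerDl opprD addrACA.
by rewrite (le_trans (nrmD _ _)) // lerD.
Qed.

Lemma posZ (r : R) x : 0 <= r -> pos x -> pos (r *: x).
Proof.
move=> r0 [xs [T xT]]; split; first exact: saZ.
by exists (r * T); rewrite -scalerA -scalerBr nrmZ ger0_norm // ler_wpM2l.
Qed.

Lemma pos_alg (r : R) : 0 <= r -> pos r%:A.
Proof.
move=> r0; split; first exact: sa_alg.
by exists r; rewrite subrr -(scale0r 0) nrmZ normr0 mul0r.
Qed.

(** The norm itself can serve as the witness [T]: [x] is nearly a square [s^2], and [nrm_algB_sq]
    accepts any positive bound of [nrm s ^+ 2]. This canonical choice is what lets positivity pass
    to limits. *)
Lemma pos_nrm x : pos x -> nrm ((nrm x)%:A - x) <= nrm x.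
Proof.
move=> px; apply/ler_addgt0Pr => e e0.
have e4 : 0 < e / 4 by lra.
have [s [sa_s sx _]] := approx_sqrt px e4.
have s0 : 0 < nrm x + e / 4 by rewrite ltr_wpDl ?nrm_ge0.
have sT : nrm s ^+ 2 <= nrm x + e / 4.
  rewrite -nrm_sa2 // (le_trans (nrm_le_dist _ x)) // lerD2l nrmBC //.
have h := nrm_algB_sq sa_s s0 sT.
have := nrm_algB (nrm x) (nrm x + e / 4) (s ^+ 2) x.
rewrite opprD addrA subrr add0r normrN gtr0_norm // (nrmBC (s ^+ 2)).
lra.
Qed.

Lemma pos_lim x : sa x -> (forall e : R, 0 < e ->
  exists2 y, pos y & nrm (x - y) <= e) -> pos x.
Proof.
move=> xs xlim; split=> //; exists (nrm x); apply/ler_addgt0Pr => e e0.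
have [|y py xy] := xlim (e / 3); first lra.
have := pos_nrm py; have := nrm_algB (nrm x) (nrm y) y x.
have := nrm_le_dist y x; have := nrm_le_dist x y; rewrite (nrmBC y x).
have : `|nrm x - nrm y| <= nrm (x - y).
  have := nrm_le_dist y x; have := nrm_le_dist x y; rewrite (nrmBC y x).
  by move=> *; rewrite ler_norml; apply/andP; split; lra.
by move=> *; lra.
Qed.

(** Approximate square roots of commuting positive elements commute, so the claim reduces to
    [nrm_sum_sq]. *)
Lemma pos_le_nrm x y : pos x -> pos y -> GRing.comm x y ->
  nrm x <= nrm (x + y).
Proof.
move=> px py xy; apply/ler_addgt0Pr => e e0; have e3 : 0 < e / 3 by lra.
have [s [ss sx cs]] := approx_sqrt px e3.
have [t [st ty ct]] := approx_sqrt py e3.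
have cst : s * t = t * s.
  by apply: ct; apply/commr_sym; apply: cs; exact/commr_sym.
have := nrm_sum_sq ss st cst.
have := nrm_le_dist x (s ^+ 2).
have := nrm_le_dist (s ^+ 2 + t ^+ 2) (x + y).
rewrite nrmBC opprD addrACA; have := nrmD (x - s ^+ 2) (y - t ^+ 2).
by move=> *; lra.
Qed.

Lemma posM x y : pos x -> pos y -> GRing.comm x y -> pos (x * y).
Proof.
move=> px py xy.
apply: pos_lim => [|e e0]; first by apply: saM => //; case: px; case: py.
have y1 : 0 < nrm y + 1 by rewrite ltr_wpDl ?nrm_ge0.
(* [x * y] is compared with [s^2 * y] and then with [s^2 * t^2], each at cost [e / 2]; the second
   tolerance depends on [s]. Adding 1 keeps the denominators positive. *)
have [|s [ss sx cs]] := approx_sqrt (e := e / 2 / (nrm y + 1)) px.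
  by rewrite !divr_gt0.
have s1 : 0 < nrm (s ^+ 2) + 1 by rewrite ltr_wpDl ?nrm_ge0.
have [|t [st ty ct]] := approx_sqrt (e := e / 2 / (nrm (s ^+ 2) + 1)) py.
  by rewrite !divr_gt0.
have cst : s * t = t * s.
  by apply: ct; apply/commr_sym; apply: cs; exact/commr_sym.
exists ((s * t) ^+ 2); first by apply: pos_sq; exact: saM.
rewrite exprMn_comm // (le_trans (nrm_dist _ (s ^+ 2 * y) _)) //.
rewrite -mulrBl -mulrBr [leRHS](splitr e).
apply: lerD; apply: (le_trans (nrmM _ _)).
- move: sx; rewrite ler_pdivlMr //; apply: le_trans.
  by rewrite ler_wpM2l ?nrm_ge0 // lerDl.
- move: ty; rewrite ler_pdivlMr // mulrC; apply: le_trans.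
  by rewrite ler_wpM2r ?nrm_ge0 // lerDl.
Qed.

Lemma posX x n : pos x -> pos (x ^+ n).
Proof.
move=> px; elim: n => [|n IH].
  by rewrite expr0 -[1]scale1r; exact: pos_alg.
by rewrite exprS; apply: posM => //; exact: commrX.
Qed.

End Positivity.

(** * Positivity of [adj c * c] and of conjugates *)

Section PositivityStar.
Variables (R : realType) (A : cstarAlgType R).
Local Notation B := (calg A).
Implicit Types (x y z a b c d s t u : B) (p q : {poly R}).

(* With [a = c + adj c] and [b = i (c - adj c)] self-adjoint, this is
   [(a^2 + b^2) / 2]. *)
Lemma pos_adjMD c : pos (adj c * c + c * adj c).
Proof.
set e := adj c; have ec : adj e = c by exact: adjK.
have sa_a : sa (c + e) by rewrite /sa adjD ec addrC.
have sa_b : sa (imu A * (c - e)).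
  by rewrite /sa adjM adjB ec -/e adj_imu mulrN -mulNr opprB imu_comm.
have -> : e * c + c * e = 2^-1 *: ((c + e) ^+ 2 + (imu A * (c - e)) ^+ 2).
  rewrite exprMn_comm; last exact: imu_comm.
  rewrite [imu A ^+ 2]expr2 imuM mulN1r !expr2 mulrDr (mulrBr (c - e)) opprB.
  rewrite [_ * e - _]addrC addrACA -mulrBl -mulrDl.
  have -> : c + e - (c - e) = e + e by rewrite opprB addrC addrA subrK.
  have -> : c + e + (c - e) = c + c by rewrite [c - e]addrC addrA addrK.
  rewrite !mulrDl addrACA -mulr2n -[X in _ *: X]scaler_nat scalerA.
  by rewrite mulVf ?scale1r.
by apply: posZ; rewrite ?invr_ge0 //; apply: posD; exact: pos_sq.
Qed.

(** Passing from [n] to [n.+1] adds [x^n (1 - x)^2], a product of commuting positive elements. *)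
Lemma pos_bernoulli x n : pos x -> pos (1 - (x ^+ n - x ^+ n.+1)).
Proof.
move=> px; elim: n => [|n IH]; first by rewrite expr0 expr1 subKr.
have E : (1 - ('X ^+ n.+1 - 'X ^+ n.+2) : {poly R}) =
    1 - ('X ^+ n - 'X ^+ n.+1) + 'X ^+ n * (1 - 'X) ^+ 2.
  by rewrite !exprS; ring.
have := congr1 (horner_alg x) E.
rewrite !(rmorphD, rmorphN, rmorphM, rmorphXn, rmorph1) /= horner_algX => ->.
apply: posD => //; apply: posM; first exact: posX.
  by apply: pos_sq; apply: saB; [exact: sa1 | case: px].
by rewrite -expr2; apply: commrX; apply: commrB;
  [exact: commr1 | exact/commr_sym/commrX].
Qed.

Lemma nrm_1B_adjM c : nrm c <= 1 -> nrm (1 - adj c * c) <= 1.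
Proof.
move=> c1; have c0 := nrm_ge0 c.
set h := adj c * c; pose k := c * adj c; pose G := 1 - h; pose L := 1 - k.
have pG : pos G.
  split; first by apply: saB; [exact: sa1 | rewrite /sa /h adjM adjK].
  by exists 1; rewrite scale1r subKr nrm_adjM expr_le1.
have pL : pos L.
  split; first by apply: saB; [exact: sa1 | rewrite /sa /k adjM adjK].
  exists 1; rewrite scale1r subKr /k -{1}(adjK c) nrm_adjM nrm_adj expr_le1 //.
(* Both [c * G] and [L * c] equal [c - c * adj c * c]. *)
have cG n : c * G ^+ n = L ^+ n * c.
  elim: n => [|n IH]; first by rewrite !expr0 mulr1 mul1r.
  rewrite exprSr mulrA IH exprSr -!mulrA; congr (_ * _).
  by rewrite mulrBr mulrBl mulr1 mul1r mulrA.
have GL n : pos (G ^+ (n + n) - G ^+ (n + n).+1 +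
                 (L ^+ (n + n) - L ^+ (n + n).+1)).
  have := pos_adjMD (c * G ^+ n).
  have [sG _] := pG; rewrite adjM (saX n sG).
  have -> : G ^+ n * adj c * (c * G ^+ n) = G ^+ (n + n) - G ^+ (n + n).+1.
    rewrite -mulrA (mulrA (adj c)) -/h (_ : h = 1 - G); last by rewrite subKr.
    rewrite mulrBl mul1r mulrBr -exprD mulrA -exprSr -exprD.
    by rewrite addSn.
  have -> : c * G ^+ n * (G ^+ n * adj c) = L ^+ (n + n) - L ^+ (n + n).+1.
    rewrite mulrA -(mulrA c) -exprD cG -mulrA -/k (_ : k = 1 - L).
      by rewrite mulrBr mulr1 -exprSr.
    by rewrite subKr.
  by [].
pose r := nrm G.
(* Adding [pos_bernoulli] for [L] cancels the powers of [L] and leaves [G^(2n) - G^(2n+1) + 1]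
   positive; it commutes with [G^(2n+1)], so [pos_le_nrm] applies. *)
have step n : nrm (G ^+ (n + n).+1) <= r ^+ (n + n) + 1.
  have := posD (GL n) (pos_bernoulli (n + n) pL).
  rewrite [1 - _]addrC addrA addrK => py.
  apply: (le_trans (pos_le_nrm (posX (n + n).+1 pG) py _)).
    have GG m : GRing.comm (G ^+ (n + n).+1) (G ^+ m).
      by apply: commrX; apply/commr_sym; exact: commrX.
    by apply: commrD; [exact: commrB | exact: commr1].
  rewrite addrA [_ + (_ - _)]addrC subrK (le_trans (nrmD _ _)) // nrm1 lerD2r.
  exact: nrmX.
rewrite leNgt; apply/negP => r1; rewrite -/G -/r in r1.
have r0 : 0 < r by apply: lt_trans r1.
have rI : 0 <= r^-1 < 1 by rewrite invr_ge0 ltW // invf_lt1.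
have rB : 0 < r - 1 by rewrite subr_gt0.
have [m hm] := expr_lt rI rB.
(* A power of two makes [(2n+1) + (2n-1) = 4n] one as well, so [nrm (G ^+ 4n)] is exactly [r ^+ 4n].
   Splitting it gives [r^(2n+1) <= r^(2n) + 1], against [big]. *)
pose n := (2 ^ m)%N.
have big : 1 < (r - 1) * r ^+ (n + n).
  apply: (@lt_le_trans _ _ ((r - 1) * r ^+ m)).
    by move: hm; rewrite exprVn -[_^-1]mul1r ltr_pdivrMr ?exprn_gt0.
  rewrite ler_pM2l // ler_weXn2l ?(ltW r1) //.
  by rewrite (leq_trans (ltnW (ltn_expl m (isT : 1 < 2)%N))) // leq_addr.
have [sG _] := pG.
have := nrm_saX2n m.+2 sG.
have n0 : (0 < n)%N by rewrite expn_gt0.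
have -> : (2 ^ m.+2 = (n + n).+1 + (n + n).-1)%N by rewrite !expnS -/n; lia.
rewrite exprD => e; have := nrmM (G ^+ (n + n).+1) (G ^+ (n + n).-1).
rewrite e -/r exprD => le1; have le2 := nrmX G (n + n).-1; rewrite -/r in le2.
have : r ^+ (n + n).+1 * r ^+ (n + n).-1 <=
       (r ^+ (n + n) + 1) * r ^+ (n + n).-1.
  by apply: (le_trans le1); rewrite ler_pM ?nrm_ge0.
rewrite ler_pM2r ?exprn_gt0 // exprS; move: big.
by rewrite mulrBl mul1r => *; lra.
Qed.

Lemma pos_adjM c : pos (adj c * c).
Proof.
(* Rescaling by [M] brings [c] into the unit ball. *)
pose M := nrm c + 1; have M0 : 0 < M by rewrite ltr_wpDl ?nrm_ge0.
have -> : adj c * c = M ^+ 2 *: (adj (M^-1 *: c) * (M^-1 *: c)).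
  rewrite adjZ -scalerAl -scalerAr !scalerA -[LHS]scale1r; congr (_ *: _).
  by field; rewrite gt_eqF.
apply: posZ; first exact: sqr_ge0.
split; first by rewrite /sa adjM adjK.
exists 1; rewrite scale1r nrm_1B_adjM // nrmZ gtr0_norm ?invr_gt0 //.
by rewrite ler_pdivrMl // mulr1 lerDl.
Qed.

(** If [s^2] approximates [x], then [adj (s * c) * (s * c)] approximates the conjugate. *)
Lemma pos_conj c x : pos x -> pos (adj c * x * c).
Proof.
move=> px; have [xs _] := px.
apply: pos_lim; first by rewrite /sa !adjM adjK xs mulrA.
move=> e e0; pose M := nrm c ^+ 2 + 1.
have M0 : 0 < M by rewrite ltr_wpDl ?sqr_ge0.
have [s [sa_s sx _]] := approx_sqrt px (divr_gt0 e0 M0).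
exists (adj (s * c) * (s * c)); first exact: pos_adjM.
rewrite adjM sa_s -mulrA -[_ * s * _]mulrA -mulrBr (mulrA s) -expr2 -mulrBl.
move: sx; rewrite ler_pdivlMr // => sx.
rewrite (le_trans (nrmM _ _)) // nrm_adj.
apply: (le_trans (ler_wpM2l (nrm_ge0 _) (nrmM _ _))).
apply: le_trans sx; rewrite mulrCA -expr2 ler_wpM2l ?nrm_ge0 // lerDl //.
Qed.

Lemma pos_sum n (F : 'I_n -> B) : (forall i, pos (F i)) -> pos (\sum_i F i).
Proof.
move=> pF; elim/big_ind: _ => //; last exact: posD.
by rewrite -(scale0r 1); exact: pos_alg.
Qed.

Lemma pos_algE (r : R) : pos (r%:A : B) -> 0 <= r.
Proof.
move=> /pos_nrm; rewrite -scalerBl !nrm_alg => h; rewrite leNgt.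
apply/negP => r0; move: h; rewrite (ltr0_norm r0) gtr0_norm; lra.
Qed.

Lemma adj_sum n (F : 'I_n -> B) : adj (\sum_i F i) = \sum_i adj (F i).
Proof. by apply: big_morph; [exact: adjD | exact: adj0]. Qed.

(** * Closed C*-convex half-spaces and their scalar points *)

Definition half_space (w : B) (r : R) : set A :=
  [set x | pos (w * (x : B) + adj (w * (x : B)) + r%:A)].

Lemma closed_half_space w r : closed (half_space w r).
Proof.
move=> x xK; apply: pos_lim => [|e e0].
  apply: saD; last exact: sa_alg.
  by rewrite /sa adjD adjK addrC.
(* The defining expression varies by at most [2 * nrm w] times the change in [x]. *)
pose M := 2 * nrm w + 1.
have M0 : 0 < M by rewrite ltr_wpDl // mulr_ge0 ?nrm_ge0.
have eM : 0 < (e / M)%:C%C :> R[i] by rewrite ltcR divr_gt0.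
have [y [yK]] := xK _ (nbhsx_ballx x _ eM).
rewrite -ball_normE /ball_ /= (nrmE (x - y)) ltcR => xy.
exists (w * y + adj (w * y) + r%:A) => //.
rewrite opprD addrACA subrr addr0 opprD addrACA -adjB -mulrBr.
apply: (le_trans (nrmD _ _)); rewrite nrm_adj.
apply: (le_trans (lerD (nrmM _ _) (nrmM _ _))).
move: xy; rewrite ltr_pdivlMr // => /ltW; apply: le_trans.
by rewrite /M; have := nrm_ge0 (x - y : B); lra.
Qed.

Lemma cstar_convex_half_space w r : (forall x, GRing.comm w x) ->
  cstar_convex (half_space w r).
Proof.
move=> wC n x a _ xK a1; rewrite /half_space /=.
(* Centrality of [w] moves it inside each conjugation, and [a1] spreads the constant [r] over the
   summands. *)
have -> : w * (\sum_(i < n) (a i)^† ** x i ** a i) +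
    adj (w * (\sum_(i < n) (a i)^† ** x i ** a i)) + r%:A =
  \sum_(i < n) adj (a i : B) * (w * (x i : B) + adj (w * (x i : B)) + r%:A) *
     (a i : B).
  have E i : w * ((a i)^† ** x i ** a i) =
      adj (a i : B) * (w * (x i : B)) * (a i : B).
    rewrite -[_ ** _ ** _]/(adj (a i : B) * (x i : B) * (a i : B)).
    by rewrite !mulrA wC.
  have rE : r%:A = \sum_(i < n) adj (a i : B) * r%:A * (a i : B).
    under eq_bigr => i _ do rewrite mulr_algr -scalerAl.
    by rewrite -scaler_sumr; congr (_ *: _); exact/esym.
  rewrite [X in _ + X = _]rE mulr_sumr adj_sum -!big_split /=.
  apply: eq_bigr => i _; rewrite E mulrDr mulrDr mulrDl mulrDl.
  congr (_ + _ + _).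
  by rewrite !adjM adjK !mulrA.
by apply: pos_sum => i; apply: pos_conj; exact: xK.
Qed.

(** The scalar [x + i y] times the unit, with [imu] supplying [i] because [calg A] is an algebra
    over the reals. *)
Definition cplx (x y : R) : B := x%:A + y *: imu A.

Lemma cplx_comm (x y : R) (z : B) : GRing.comm (cplx x y) z.
Proof.
rewrite /GRing.comm mulrDl mulrDr mulr_algl mulr_algr.
by rewrite -scalerAl -scalerAr imu_comm.
Qed.

Lemma half_space_cplx (u v r x y : R) :
  half_space (cplx u v) r (cplx x y) <-> 0 <= 2 * (u * x - v * y) + r.
Proof.
rewrite /half_space /=.
have -> : cplx u v * cplx x y = cplx (u * x - v * y) (u * y + v * x).
  rewrite /cplx mulrDl mulr_algl -scalerAl mulrDr mulr_algr -scalerAr imuM.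
  rewrite !scalerDr !scalerA !scalerN scalerBl scalerDl.
  by rewrite [_ *: imu A - _]addrC addrACA.
have -> : adj (cplx (u * x - v * y) (u * y + v * x)) =
    (u * x - v * y)%:A - (u * y + v * x) *: imu A.
  by rewrite adjD adj_alg adjZ adj_imu scalerN.
rewrite /cplx addrACA subrr addr0 -!scalerDl -mulr2n mulr_natl.
by split; [exact: pos_algE | exact: pos_alg].
Qed.

End PositivityStar.

Theorem theorem3p2 (R : realType) (A : cstarAlgType R) :
  exists (I : Type) (a : I -> A),
    infinite_set [set: I] /\ cstar0_polyhedron a.
Proof.
pose pt (m : R) : A := cplx A m (m ^+ 2).
(* The shift skips [pt 0], which is the point 0 itself. *)
exists nat, (fun i => pt i.+1%:R); split; first exact: infinite_nat.
move=> i; set n : R := i.+1%:R.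
have n1 : 1 <= n by rewrite ler1n.
(* Multiplying [m + m^2 i] by [-2n - i] has real part [m^2 - 2nm]; the constant completes it to
   [2 ((m - n)^2 - 1)], negative at [m = n] and nonnegative at every other integer. *)
pose K := half_space (cplx A (- (2 * n)) (-1)) (2 * (n ^+ 2 - 1)).
have K_pt (m : R) : K (pt m) <-> 1 <= (m - n) ^+ 2.
  rewrite /K /pt half_space_cplx.
  have -> : 2 * (- (2 * n) * m - -1 * m ^+ 2) + 2 * (n ^+ 2 - 1) =
            2 * ((m - n) ^+ 2 - 1) by ring.
  by rewrite pmulr_rge0 // subr_ge0.
have closedK : closed K by exact: closed_half_space.
have convexK : cstar_convex K.
  by apply: cstar_convex_half_space => x; exact: cplx_comm.
have nK : ~ K (pt n) by rewrite K_pt subrr expr0n /=; lra.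
move=> /(_ K) hK; apply/nK/hK.
split; first by [].
move=> _ [[j ji <-]|->].
  apply/K_pt; have [lt_ji|lt_ij|//] := ltngtP j i.
  - by rewrite -sqrrN opprB exprn_ege1 // lerBrDl natr1 ler_nat.
  - by rewrite exprn_ege1 // lerBrDl natr1 ler_nat.
suff -> : 0 = pt 0 by apply/K_pt; rewrite sub0r sqrrN exprn_ege1.
by rewrite /pt /cplx expr0n !scale0r addr0.
Qed.
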